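(* For every $p\in(1,\infty)$, neither $C_p$ nor $C_{l_p}$ is a monotone under incoherent channels. That is, for every $p\in(1,\infty)$ and each $C\in\{C_p,C_{l_p}\}$ there exist a dimension $d$, a state $\rho$ on $\mathbb{C}^d$ and an incoherent channel $\Lambda$ on $d\times d$ matrices such that $C(\Lambda[\rho])>C(\rho)$.
   Context: Work in $\mathbb{C}^d$ with its fixed standard basis (on tensor products, the product basis). A state is a positive semidefinite complex matrix of trace $1$; an incoherent state is a diagonal state, and $\mathcal{I}$ is the set of incoherent states of the relevant dimension. For a matrix $X=(x_{ij})$ and $p\in[1,\infty)$, $\|X\|_{l_p}=\big(\sum_{i,j}|x_{ij}|^p\big)^{1/p}$ and $\|X\|_p=(\mathrm{Tr}|X|^p)^{1/p}$ with $|X|=\sqrt{X^\dagger X}$ (Schatten-$p$ norm). For a state $\rho$, $C_{l_p}(\rho):=\min_{\delta\in\mathcal{I}}\|\rho-\delta\|_{l_p}$ and $C_p(\rho):=\min_{\delta\in\mathcal{I}}\|\rho-\delta\|_p$. A matrix $K$ with $d$ columns is an incoherent Kraus operator if $K\delta K^\dagger$ is diagonal for every incoherent state $\delta$ on $\mathbb{C}^d$. An incoherent channel is a map $\Lambda[\rho]=\sum_nK_n\rho K_n^\dagger$ with finitely many incoherent Kraus operators $K_n$ satisfying $\sum_nK_n^\dagger K_n=\mathbb{1}_d$, the $d\times d$ identity. A function $C$ on states is a monotone if $C(\Lambda[\rho])\le C(\rho)$ for all states $\rho$ and all incoherent channels $\Lambda$. *)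

(* Defs.v *)
From mathcomp Require Import all_boot all_order all_algebra.
From mathcomp Require Import complex.
From mathcomp Require Import classical_sets reals exp.

Set Implicit Arguments.
Unset Strict Implicit.
Unset Printing Implicit Defensive.

Import Order.TTheory GRing.Theory Num.Theory.
Local Open Scope ring_scope.
Local Open Scope classical_set_scope.
Local Open Scope sesquilinear_scope.
Local Open Scope complex_scope.

(* Vectors are columns, and M ^t* is the conjugate transpose of M. *)

Section Coherence.
Variable R : realType.

(* The norm on R[i] takes its values in R[i]; this is the same value in R. *)
Definition modulus (z : R[i]) : R := complex.Re `|z|.

Definition psdmx d (A : 'M[R[i]]_d) : Prop :=
  A \is hermsymmx /\ forall v : 'cV[R[i]]_d, 0 <= (v ^t* *m A *m v) 0 0.

Definition is_state d (rho : 'M[R[i]]_d) : Prop := psdmx rho /\ \tr rho = 1.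

Definition is_incoherent d (delta : 'M[R[i]]_d) : Prop :=
  is_state delta /\ is_diag_mx delta.

(* Functional calculus f(A) of a Hermitian matrix A, for f : R -> R.  The
   eigenvalues listed in [spectral_diag A] are then real, and
   A = U ^t* *m diag_mx (spectral_diag A) *m U with U := spectralmx A unitary.
   The value is irrelevant when A is not Hermitian. *)
Definition hermfun (f : R -> R) d (A : 'M[R[i]]_d) : 'M[R[i]]_d :=
  (spectralmx A) ^t*
  *m diag_mx (map_mx (fun z : R[i] => (f (complex.Re z))%:C) (spectral_diag A))
  *m spectralmx A.

Definition absmx d (X : 'M[R[i]]_d) : 'M[R[i]]_d :=
  hermfun Num.sqrt (X ^t* *m X).

Definition schatten_norm (p : R) d (X : 'M[R[i]]_d) : R :=
  (complex.Re (\tr (hermfun (fun x => x `^ p) (absmx X)))) `^ p^-1.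

Definition lp_norm (p : R) d (X : 'M[R[i]]_d) : R :=
  (\sum_i \sum_j modulus (X i j) `^ p) `^ p^-1.

(* Distances to the set of incoherent states.  For 1 <= p and d > 0 that set is
   nonempty and compact and the norm is continuous, so the infimum is a
   minimum; there is no state in dimension 0. *)
Definition schatten_coherence (p : R) d (rho : 'M[R[i]]_d) : R :=
  inf [set schatten_norm p (rho - delta) | delta in @is_incoherent d].

Definition lp_coherence (p : R) d (rho : 'M[R[i]]_d) : R :=
  inf [set lp_norm p (rho - delta) | delta in @is_incoherent d].

Definition incoherent_kraus d' d (K : 'M[R[i]]_(d', d)) : Prop :=
  forall delta : 'M[R[i]]_d, is_incoherent delta ->
    is_diag_mx (K *m delta *m K ^t*).

(* The output dimension d' need not be equal to the input dimension d. *)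
Definition incoherent_channel d d'
    (Lambda : 'M[R[i]]_d -> 'M[R[i]]_d') : Prop :=
  exists (N : nat) (K : 'I_N -> 'M[R[i]]_(d', d)),
    [/\ forall n, incoherent_kraus (K n),
        \sum_n (K n) ^t* *m K n = 1%:M
      & forall rho, Lambda rho = \sum_n K n *m rho *m (K n) ^t*].

Definition is_monotone (C : forall d, 'M[R[i]]_d -> R) : Prop :=
  forall d d' (rho : 'M[R[i]]_d) (Lambda : 'M[R[i]]_d -> 'M[R[i]]_d'),
    is_state rho -> incoherent_channel Lambda -> C d' (Lambda rho) <= C d rho.

End Coherence.

(* Main.v *)
Require Import Defs.
From mathcomp Require Import all_boot all_order all_algebra.
From mathcomp Require Import complex.
From mathcomp Require Import classical_sets reals exp.

Set Implicit Arguments.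
Unset Strict Implicit.
Unset Printing Implicit Defensive.

Import Order.TTheory GRing.Theory Num.Theory.
Local Open Scope ring_scope.
Local Open Scope sesquilinear_scope.
Local Open Scope complex_scope.

(* Up to reordering the basis, let rho be |+><+| (x) 1/m on C^(2m), and let the
   channel reset the second factor to |0><0|.  Subtracting the maximally mixed
   state from rho leaves 1/(2m) times a permutation matrix, so for both norms
   the coherence of rho is at most (2m)^(1/p - 1), which tends to 0 as m grows
   since p > 1.  The output has an off-diagonal entry 1/2, which no incoherent
   state can change, and both norms dominate the modulus of every entry; so
   the coherence of the output is at least 1/2 whatever m is. *)

(** * Conjugate transposes and the spectral decomposition of Hermitian matrices *)

Section Adjoint.
Variable C : numClosedFieldType.

Lemma adjM m n q (A : 'M[C]_(m, n)) (B : 'M[C]_(n, q)) :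
  (A *m B) ^t* = B ^t* *m A ^t*.
Proof. by rewrite trmx_mul map_mxM. Qed.

Lemma adj_delta m n i j : (delta_mx i j : 'M[C]_(m, n)) ^t* = delta_mx j i.
Proof. by rewrite trmx_delta map_delta_mx. Qed.

Lemma hermsymmxP n (A : 'M[C]_n) : reflect (A ^t* = A) (A \is hermsymmx).
Proof.
by apply: (iffP (is_hermitianmxP _ _ _)); rewrite expr0 scale1r => /esym.
Qed.

Lemma unitarymx_mulVmx n (U : 'M[C]_n) :
  U \is unitarymx -> U ^t* *m U = 1%:M.
Proof. by move=> uU; rewrite -invmx_unitary// mulVmx ?unitarymx_unit. Qed.

Lemma hermitian_spectralE n (A : 'M[C]_n) : A \is hermsymmx ->
  A = (spectralmx A) ^t* *m diag_mx (spectral_diag A) *m spectralmx A.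
Proof.
move=> /hermitian_normalmx /orthomx_spectralP {1}->.
by rewrite invmx_unitary ?spectral_unitarymx.
Qed.

Lemma gram_mx_diagE m n (X : 'M[C]_(m, n)) j :
  (X ^t* *m X) j j = \sum_i `|X i j| ^+ 2.
Proof. by rewrite mxE; apply: eq_bigr => i _; rewrite !mxE mulrC -normCK. Qed.

End Adjoint.

Section Coherence.
Variable R : realType.
Local Notation C := R[i].

(** * Moduli and positive semidefinite matrices *)

Lemma modulus_ge0 (z : C) : 0 <= modulus z.
Proof. by rewrite /modulus normc_def sqrtr_ge0. Qed.

Lemma modulusE (z : C) : (modulus z)%:C = `|z|.
Proof. by rewrite /modulus RRe_real ?normr_real. Qed.

Lemma gram_psd m d (M : 'M[C]_(m, d)) : psdmx (M ^t* *m M).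
Proof.
split=> [|v]; first by apply/hermsymmxP; rewrite adjM trmxCK.
rewrite mulmxA -adjM -mulmxA gram_mx_diagE.
by apply: sumr_ge0 => i _; rewrite exprn_ge0.
Qed.

Lemma psdmx_scale d (c : C) (A : 'M[C]_d) : 0 <= c -> psdmx A -> psdmx (c *: A).
Proof.
move=> c0 [/hermsymmxP hA pA]; split=> [|v]; last first.
  by rewrite -scalemxAr -scalemxAl mxE mulr_ge0.
apply/hermsymmxP; rewrite linearZ map_mxZ hA /=; congr (_ *: _).
by rewrite geC0_conj.
Qed.

(** * Functional calculus and the absolute value of a matrix *)

Section FunctionalCalculus.
Variable d : nat.
Implicit Types (f g : R -> R) (A : 'M[C]_d).

Lemma hermfun_herm f A : hermfun f A \is hermsymmx.
Proof.
apply/hermsymmxP; rewrite /hermfun !adjM trmxCK mulmxA; congr (_ *m _ *m _).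
rewrite tr_diag_mx map_diag_mx -map_mx_comp; congr diag_mx.
by apply/rowP=> i; rewrite !mxE /=; apply: conjc_real.
Qed.

Lemma hermfun_mul f g A :
  hermfun f A *m hermfun g A = hermfun (fun x => f x * g x) A.
Proof.
rewrite /hermfun !mulmxA; congr (_ *m _); rewrite -!mulmxA; congr (_ *m _).
rewrite !mulmxA mulmxtVK ?spectral_unitarymx// mulmx_diag.
by congr diag_mx; apply/rowP=> i; rewrite !mxE rmorphM.
Qed.

Lemma eq_hermfun f g A :
  (forall i, f (complex.Re (spectral_diag A 0 i)) =
             g (complex.Re (spectral_diag A 0 i))) ->
  hermfun f A = hermfun g A.
Proof.
move=> fg; rewrite /hermfun; congr (_ *m diag_mx _ *m _).
by apply/rowP=> i; rewrite !mxE fg.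
Qed.

(** The eigenvalues of a Hermitian matrix are real, so taking real parts in [hermfun] loses
    nothing. *)
Lemma hermfun_id A : A \is hermsymmx -> hermfun id A = A.
Proof.
move=> hA; rewrite {2}(hermitian_spectralE hA) /hermfun.
congr (_ *m diag_mx _ *m _); apply/rowP=> i; rewrite !mxE RRe_real//.
by have /mxOverP := hermitian_spectral_diag_real hA.
Qed.

(** Applying the square root of [f] to [A] gives a Hermitian matrix whose square is [hermfun f A],
    which is thus a Gram matrix. *)
Lemma hermfun_psd f A : (forall x, 0 <= f x) -> psdmx (hermfun f A).
Proof.
move=> f0; have -> : hermfun f A =
    (hermfun (Num.sqrt \o f) A) ^t* *m hermfun (Num.sqrt \o f) A.
  rewrite (hermsymmxP _ (hermfun_herm _ _)) hermfun_mul.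
  by apply: eq_hermfun => i /=; rewrite -expr2 sqr_sqrtr.
exact: gram_psd.
Qed.

(** The quadratic form of [A], evaluated at the [i]-th eigenvector, is the [i]-th eigenvalue. *)
Lemma spectral_diag_ge0 A i : psdmx A -> 0 <= spectral_diag A 0 i.
Proof.
move=> [hA /(_ ((spectralmx A) ^t* *m delta_mx i 0))].
rewrite {2}(hermitian_spectralE hA) adjM trmxCK adj_delta !mulmxA.
rewrite mulmxtVK ?spectral_unitarymx// mulmxtVK ?spectral_unitarymx//.
by rewrite -rowE -colE !mxE eqxx mulr1n.
Qed.

Lemma Re_spectral_diag_ge0 A i :
  psdmx A -> 0 <= complex.Re (spectral_diag A 0 i).
Proof. by move=> /(spectral_diag_ge0 i); rewrite lecE => /andP[]. Qed.

Lemma mxtrace_hermfun f A :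
  complex.Re (\tr (hermfun f A)) =
  \sum_i f (complex.Re (spectral_diag A 0 i)).
Proof.
rewrite /hermfun mxtrace_mulC mulmxA (unitarymxP (spectral_unitarymx A)) mul1mx.
by rewrite mxtrace_diag raddf_sum; apply: eq_bigr => i _; rewrite mxE.
Qed.

Lemma hermfun_scalar f (a : R) : hermfun f (a%:C%:M : 'M[C]_d) = (f a)%:C%:M.
Proof.
set A := (a%:C%:M : 'M[C]_d).
have hA : A \is hermsymmx.
  by apply/hermsymmxP; rewrite tr_scalar_mx map_scalar_mx; congr _%:M;
    apply: conjc_real.
(* The diagonalizing unitary of a scalar matrix is some unknown unitary; conjugating [A] by it still
   returns [A], which determines the eigenvalues. *)
have eigA i : spectral_diag A 0 i = a%:C.
  have /(congr1 (fun B => spectralmx A *m B *m (spectralmx A) ^t*)) :=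
    hermitian_spectralE hA.
  rewrite !mulmxA (unitarymxP (spectral_unitarymx A)) mul1mx.
  rewrite mulmxtVK ?spectral_unitarymx// /A mul_mx_scalar -scalemxAl.
  rewrite (unitarymxP (spectral_unitarymx A)) => /matrixP/(_ i i).
  by rewrite !mxE eqxx mulr1 mulr1n.
rewrite /hermfun (_ : map_mx _ _ = const_mx (f a)%:C); last first.
  by apply/rowP=> i; rewrite !mxE eigA.
rewrite diag_const_mx mul_mx_scalar -scalemxAl.
by rewrite unitarymx_mulVmx ?spectral_unitarymx// scalemx1.
Qed.

Lemma absmx_psd (X : 'M[C]_d) : psdmx (absmx X).
Proof. by apply: hermfun_psd => x; apply: sqrtr_ge0. Qed.

Lemma absmx_sqr (X : 'M[C]_d) : absmx X *m absmx X = X ^t* *m X.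
Proof.
have pX := gram_psd X.
rewrite hermfun_mul -[RHS]hermfun_id; last by case: pX.
by apply: eq_hermfun => i; rewrite -expr2 sqr_sqrtr// Re_spectral_diag_ge0.
Qed.

End FunctionalCalculus.

(** * Both norms dominate the modulus of every entry *)

Section Norms.
Variables (p : R) (p_gt0 : 0 < p) (d : nat).
Implicit Types X : 'M[C]_d.

Let p_neq0 : p != 0. Proof. by rewrite gt_eqF. Qed.

Lemma powRK (a : R) : 0 <= a -> (a `^ p) `^ p^-1 = a.
Proof. by move=> a0; rewrite -powRrM divff// powRr1. Qed.

Lemma term_le_powR_sum (I : finType) (F : I -> R) (i : I) :
  0 <= F i -> F i <= (\sum_j F j `^ p) `^ p^-1.
Proof.
move=> Fi; rewrite -{1}(powRK Fi) ge0_ler_powR ?invr_ge0 ?(ltW p_gt0)//.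
- by rewrite nnegrE powR_ge0.
- by rewrite nnegrE sumr_ge0// => j _; rewrite powR_ge0.
by rewrite (bigD1 i)//= lerDl sumr_ge0// => j _; rewrite powR_ge0.
Qed.

Lemma lp_norm_ge_entry X i j : modulus (X i j) <= lp_norm p X.
Proof.
rewrite /lp_norm pair_big /=.
exact: (@term_le_powR_sum _ (fun u => modulus (X u.1 u.2)) (i, j)
  (modulus_ge0 _)).
Qed.

(* With |X| = V^* diag(mu) V, the squared norm of column j of X is
   (|X|^2)_jj = sum_k mu_k^2 |V_kj|^2, an average of the mu_k^2. *)
Lemma schatten_norm_ge_entry X i j : modulus (X i j) <= schatten_norm p X.
Proof.
set N := schatten_norm p X; set A := absmx X; set V := spectralmx A.
have pA : psdmx A := absmx_psd X.
have N0 : 0 <= N by apply: powR_ge0.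
have eigle k : complex.Re (spectral_diag A 0 k) <= N.
  rewrite /N /schatten_norm mxtrace_hermfun.
  exact: (@term_le_powR_sum _ (fun k => complex.Re (spectral_diag A 0 k)) k
    (Re_spectral_diag_ge0 k pA)).
have colV : \sum_k `|V k j| ^+ 2 = 1.
  rewrite -gram_mx_diagE unitarymx_mulVmx ?spectral_unitarymx//.
  by rewrite mxE eqxx.
have colX : \sum_k `|X k j| ^+ 2 =
    \sum_k spectral_diag A 0 k ^+ 2 * `|V k j| ^+ 2.
  rewrite -gram_mx_diagE -absmx_sqr -/A {1 2}(hermitian_spectralE (proj1 pA)).
  rewrite -/V !mulmxA mulmxtVK ?spectral_unitarymx// -(mulmxA (V ^t* )).
  rewrite mulmx_diag -mulmxA mxE; apply: eq_bigr => k _.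
  by rewrite mul_diag_mx !mxE mulrCA -expr2 [_ * V k j]mulrC -normCK.
rewrite -(@ler_sqr _ (modulus _)) ?nnegrE ?modulus_ge0//.
rewrite -lecR !rmorphXn /= modulusE.
apply: (@le_trans _ _ (\sum_k `|X k j| ^+ 2)).
  by rewrite (bigD1 i)//= lerDl sumr_ge0// => k _; rewrite exprn_ge0.
rewrite colX -[leRHS]mulr1 -colV mulr_sumr ler_sum// => k _.
rewrite ler_wpM2r ?exprn_ge0//.
have l0 := spectral_diag_ge0 k pA.
by rewrite ler_sqr ?nnegrE ?ler0c// -(RRe_real (ger0_real l0)) lecR.
Qed.

(** Here the absolute value of [X] is [a] times the identity, so all [d] singular values equal
    [a]. *)
Lemma schatten_norm_gram_scalar X (a : R) : 0 <= a ->
  X ^t* *m X = (a ^+ 2)%:C%:M ->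
  schatten_norm p X = (d%:R * a `^ p) `^ p^-1.
Proof.
move=> a0 XX; rewrite /schatten_norm /absmx XX !hermfun_scalar sqrtr_sqr.
by rewrite ger0_norm// mxtrace_scalar raddfMn /= mulr_natl.
Qed.

End Norms.

(** * Upper and lower bounds on distances to the incoherent states *)

Section Infimum.
Variables (d : nat) (N : 'M[C]_d -> R).
Implicit Types rho delta : 'M[C]_d.
Local Notation coh rho :=
  (inf [set N (rho - delta) | delta in @is_incoherent R _]%classic).

Lemma coherence_le rho delta :
  (forall X, 0 <= N X) -> is_incoherent delta ->
  coh rho <= N (rho - delta).
Proof.
move=> N0 idelta; apply: ge_inf; last by exists delta.
(* The infimum is a lower bound only once the set is known to be bounded below; 0 serves. *)
by exists 0 => _ [x _ <-].
Qed.

(** The state [delta] witnesses that the set of distances is nonempty, without which a lower bound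
    would say nothing about [inf]. *)
Lemma coherence_ge rho delta (a : R) :
  is_incoherent delta ->
  (forall delta', is_incoherent delta' -> a <= N (rho - delta')) ->
  a <= coh rho.
Proof.
move=> idelta aN; apply: lb_le_inf; first by exists (N (rho - delta)), delta.
by move=> _ [x ix <-]; apply: aN.
Qed.

End Infimum.

(** The hypothesis says that each column of [K] has at most one nonzero entry. For diagonal [delta],
    entry (i, j) of the image is a sum over columns [l] of terms containing [K i l] and the
    conjugate of [K j l], so it vanishes when i and j differ. *)
Lemma incoherent_krausP d' d (K : 'M[C]_(d', d)) :
  (forall l i j, K i l != 0 -> K j l != 0 -> i = j) -> incoherent_kraus K.
Proof.
move=> K1 delta [_ /diag_mxP[v ->]]; apply/is_diag_mxP => i j ij.
rewrite mul_mx_diag mxE big1// => l _; rewrite !mxE.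
have [->|Ki] := eqVneq (K i l) 0; first by rewrite !mul0r.
have [->|Kj] := eqVneq (K j l) 0; first by rewrite conjC0 mulr0.
by rewrite (K1 _ _ _ Ki Kj) eqxx in ij.
Qed.

(** * The example: input state, its distance to the maximally mixed state, and the reset channel *)

Section Example.
Variable n : nat.
Local Notation m := n.+1.
Local Notation d := (m + m)%N.
Let c : R := d%:R^-1.

Let c_ge0 : 0 <= c. Proof. by rewrite invr_ge0 ler0n. Qed.

Let d_neq0 : d%:R != 0 :> C. Proof. by rewrite pnatr_eq0. Qed.

Let cC : c%:C = d%:R^-1 :> C.
Proof. by rewrite /c fmorphV rmorph_nat. Qed.

Let c_geC0 : 0 <= c%:C. Proof. by rewrite ler0c. Qed.

Let B : 'M[C]_(m, d) := row_mx 1%:M 1%:M.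

Let BB : B ^t* *m B = block_mx 1%:M 1%:M 1%:M 1%:M.
Proof.
by rewrite tr_row_mx map_col_mx !trmx1 !map_mx1 mul_col_row !mulmx1.
Qed.

(* |+><+| (x) 1/m, with the two values of the qubit indexing the blocks *)
Definition plus_mixed : 'M[C]_d := c%:C *: block_mx 1%:M 1%:M 1%:M 1%:M.

Definition max_mixed : 'M[C]_d := c%:C%:M.

Lemma plus_mixed_state : is_state plus_mixed.
Proof.
split; first by rewrite /plus_mixed -BB; apply/psdmx_scale/gram_psd.
by rewrite mxtraceZ mxtrace_block !mxtrace1 -natrD cC mulVf.
Qed.

Lemma max_mixed_incoherent : is_incoherent max_mixed.
Proof.
split; last by apply/is_diag_mxP => i j ij; rewrite mxE -val_eqE (negPf ij).
split; last by rewrite mxtrace_scalar -mulr_natr cC mulVf.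
rewrite /max_mixed -scalemx1; apply: psdmx_scale => //.
have -> : 1%:M = 1%:M ^t* *m 1%:M :> 'M[C]_d by rewrite trmx1 map_mx1 mulmx1.
exact: gram_psd.
Qed.

(** The Pauli matrix X on the qubit, tensored with the identity. *)
Definition swap_blocks : 'M[C]_d := block_mx 0 1%:M 1%:M 0.

Lemma plus_mixed_sub : plus_mixed - max_mixed = c%:C *: swap_blocks.
Proof.
rewrite /max_mixed -scalemx1 -scalerBr (scalar_mx_block m m 1) opp_block_mx.
by rewrite add_block_mx !subrr !oppr0 !addr0.
Qed.

(** Every row has exactly one nonzero entry, equal to [c]. The zero entries contribute nothing
    because [p] is nonzero, whereas 0 to the power 0 is 1. *)
Lemma lp_norm_swap (p : R) : p != 0 ->
  lp_norm p (c%:C *: swap_blocks) = (d%:R * c `^ p) `^ p^-1.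
Proof.
move=> p0; congr (_ `^ _).
have mod0 : modulus (c%:C * 0) `^ p = 0.
  by rewrite mulr0 /modulus normr0 powR0.
have sum1 (i : 'I_m) :
    \sum_(j < m) modulus (c%:C * (1%:M : 'M[C]_m) i j) `^ p = c `^ p.
  rewrite (bigD1 i)//= big1 => [|j ji]; last by rewrite mxE eq_sym (negPf ji).
  by rewrite addr0 mxE eqxx mulr1 /modulus ger0_norm.
under eq_bigr do under eq_bigr do rewrite mxE.
rewrite big_split_ord /=.
under eq_bigr => i _ do
  [rewrite big_split_ord /=; under eq_bigr do rewrite block_mxEul mxE mod0;
   under [X in _ + X]eq_bigr do rewrite block_mxEur;
   rewrite big1// add0r sum1].
under [X in _ + X]eq_bigr => i _ do
  [rewrite big_split_ord /=;
   under [X in _ + X]eq_bigr do rewrite block_mxEdr mxE mod0;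
   under eq_bigr do rewrite block_mxEdl;
   rewrite [X in _ + X]big1// addr0 sum1].
by rewrite !sumr_const card_ord -mulrnDr mulr_natl.
Qed.

Lemma schatten_norm_swap (p : R) :
  schatten_norm p (c%:C *: swap_blocks) = (d%:R * c `^ p) `^ p^-1.
Proof.
(* [swap_blocks] is a Hermitian involution, so the Gram matrix is the square of [c] times the
   identity. *)
apply: schatten_norm_gram_scalar => //.
have -> : (c%:C *: swap_blocks) ^t* = c%:C *: swap_blocks.
  rewrite linearZ map_mxZ /= geC0_conj//; congr (_ *: _).
  by rewrite tr_block_mx map_block_mx !trmx0 !trmx1 !map_mx0 !map_mx1.
rewrite -scalemxAl -scalemxAr scalerA mulmx_block !mulmx0 !mul0mx !mulmx1.
by rewrite !add0r !addr0 -scalar_mx_block scalemx1 [in RHS]rmorphXn.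
Qed.

(* 1 (x) |0><k| *)
Definition reset_kraus (k : 'I_m) : 'M[C]_d :=
  block_mx (delta_mx 0 k) 0 0 (delta_mx 0 k).

Definition reset_channel (rho : 'M[C]_d) : 'M[C]_d :=
  \sum_k reset_kraus k *m rho *m (reset_kraus k) ^t*.

Let reset_kraus_adj k : (reset_kraus k) ^t* =
  block_mx (delta_mx k 0) 0 0 (delta_mx k 0).
Proof.
by rewrite tr_block_mx map_block_mx !trmx0 !map_mx0 !adj_delta.
Qed.

Lemma reset_channel_incoherent : incoherent_channel reset_channel.
Proof.
exists m, reset_kraus; split=> [k||//].
  apply: incoherent_krausP => l i j.
  (* A nonzero entry of a column can lie only in row 0 of the block to which that column belongs. *)
  case: (split_ordP l) => l' ->; case: (split_ordP i) => i' ->;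
    case: (split_ordP j) => j' ->;
    rewrite /reset_kraus ?(block_mxEul, block_mxEur, block_mxEdl, block_mxEdr);
    rewrite !mxE ?eqxx// !pnatr_eq0 !eqb0 !negbK;
    by move=> /andP[/eqP-> _] /andP[/eqP-> _].
(* Completeness: each product of adjoint and Kraus operator is the identity on the qubit tensored
   with the projector onto the [k]-th basis vector, and these projectors sum to the identity. *)
under eq_bigr => k _ do
  rewrite reset_kraus_adj mulmx_block !mulmx0 !mul0mx !add0r !addr0
    mul_delta_mx.
apply/matrixP => i j; rewrite summxE.
have sum_delta (i' j' : 'I_m) :
    \sum_k (delta_mx k k : 'M[C]_m) i' j' = (i' == j')%:R.
  rewrite (bigD1 i')//= mxE eqxx eq_sym big1 ?addr0// => k ki.
  by rewrite mxE eq_sym (negPf ki).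
rewrite mxE.
case: (split_ordP i) => i' ->; case: (split_ordP j) => j' ->;
  under eq_bigr do
    rewrite ?(block_mxEul, block_mxEur, block_mxEdl, block_mxEdr);
  rewrite ?sum_delta ?eq_shift//; by rewrite big1// => k _; rewrite mxE.
Qed.

(** Each of the [m] Kraus operators carries one entry [c] of the off-diagonal block to this
    position, and [m] times [c] is 1/2. *)
Lemma reset_plus_mixed_entry :
  reset_channel plus_mixed (lshift m 0) (rshift m 0) = 2^-1.
Proof.
rewrite summxE; under eq_bigr => k _ do
  rewrite reset_kraus_adj -scalemxAr -scalemxAl !mulmx_block
    !(mulmx1, mulmx0, mul0mx, add0r, addr0) !mul_delta_mx
    mxE block_mxEur mxE eqxx mulr1.
rewrite sumr_const card_ord cC addnn -muln2 natrM invfM -[_ *+ m]mulr_natr.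
by rewrite mulrAC mulVf ?mul1r// pnatr_eq0.
Qed.

(** The argument common to both norms: 1/2 separates the two coherences. The hypothesis on [d] is
    what puts the norm of the scaled swap below 1/2. *)
Lemma coherence_separation (p : R) (N : 'M[C]_d -> R) :
  0 < p -> 2 `^ p < d%:R `^ (p - 1) ->
  (forall X, 0 <= N X) ->
  (forall (X : 'M[C]_d) i j, modulus (X i j) <= N X) ->
  N (c%:C *: swap_blocks) = (d%:R * c `^ p) `^ p^-1 ->
  inf [set N (plus_mixed - delta) | delta in @is_incoherent R d]%classic <
  inf [set N (reset_channel plus_mixed - delta)
         | delta in @is_incoherent R d]%classic.
Proof.
move=> p0 large N0 Nentry Nswap.
have powV (x : R) : 0 <= x -> x^-1 `^ p = (x `^ p)^-1.
  by move=> x0; rewrite -powR_inv1// -powRrM mulN1r powRN.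
(* As [c] is the inverse of [d], the left side is the inverse of [d] to the power [p - 1], so this
   is the hypothesis on [d] with both sides inverted. *)
have dp : d%:R * c `^ p < 2^-1 `^ p.
  rewrite /c !powV ?ler0n// -(@mulr_powRB1 _ d%:R)// invfM mulrA divff ?mul1r//.
    by rewrite ltf_pV2// posrE powR_gt0// ltr0n.
  by rewrite pnatr_eq0.
apply: (@lt_le_trans _ _ 2^-1).
  apply: (le_lt_trans (coherence_le plus_mixed N0 max_mixed_incoherent)).
  rewrite plus_mixed_sub Nswap -[ltRHS](powRK p0) ?invr_ge0//.
  by rewrite gt0_ltr_powR ?invr_gt0 ?nnegrE ?mulr_ge0 ?powR_ge0 ?ler0n.
apply: (coherence_ge max_mixed_incoherent) => delta [_ ddelta].
apply: le_trans (Nentry _ (lshift m 0) (rshift m 0)).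
(* The chosen entry is off the diagonal, where [delta] vanishes. *)
rewrite mxE mxE reset_plus_mixed_entry (is_diag_mxP ddelta)//.
rewrite subr0 -lecR modulusE ger0_norm ?invr_ge0 ?ler0n//.
by rewrite fmorphV rmorph_nat.
Qed.

End Example.
End Coherence.

(** * Choice of the dimension for a given exponent *)

Theorem proposition9 (R : realType) (p : R) (hp : 1 < p)
    (C : forall d : nat, 'M[R[i]]_d -> R)
    (hC : C = @schatten_coherence R p \/ C = @lp_coherence R p) :
  ~ is_monotone C /\
  exists (d : nat) (rho : 'M[R[i]]_d) (Lambda : 'M[R[i]]_d -> 'M[R[i]]_d),
    [/\ is_state rho, incoherent_channel Lambda & C d rho < C d (Lambda rho)].
Proof.
suff [d [rho [Lambda [srho iLambda lt_C]]]] : exists (d : nat)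
    (rho : 'M[R[i]]_d) (Lambda : 'M[R[i]]_d -> 'M[R[i]]_d),
    [/\ is_state rho, incoherent_channel Lambda & C d rho < C d (Lambda rho)].
  split; last by exists d, rho, Lambda.
  by move=> /(_ d d rho Lambda srho iLambda); rewrite leNgt lt_C.
have p0 : 0 < p by apply: lt_trans hp.
(* [x] solves the equation that equates its power [p - 1] with 2 to the power [p]; any dimension
   above [x] is large enough, and [n.+1] already exceeds [x]. *)
set x : R := 2 `^ (p / (p - 1)); set n := Num.truncn x.
have large : 2 `^ p < (n.+1 + n.+1)%:R `^ (p - 1).
  have -> : 2 `^ p = x `^ (p - 1).
    by rewrite -powRrM divfK// subr_eq0 gt_eqF.
  rewrite gt0_ltr_powR ?subr_gt0 ?nnegrE ?powR_ge0 ?ler0n//.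
  by apply: lt_le_trans (truncnS_gt x) _; rewrite ler_nat leq_addr.
exists (n.+1 + n.+1)%N, (plus_mixed R n), (@reset_channel R n).
split; [exact: plus_mixed_state|exact: reset_channel_incoherent|].
case: hC => ->.
- apply: (coherence_separation (N := @schatten_norm R p _) p0 large).
  + by move=> X; apply: powR_ge0.
  + exact: schatten_norm_ge_entry.
  + exact: schatten_norm_swap.
- apply: (coherence_separation (N := @lp_norm R p _) p0 large).
  + by move=> X; apply: powR_ge0.
  + exact: lp_norm_ge_entry.
  + by apply: lp_norm_swap; rewrite gt_eqF.
Qed.
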